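(* For every $d\ge 2$, the $(d+1)$-dimensional cross polytope (octahedron) is Möbius unique.
   Context: Identify $\widehat{\mathbb{R}^d}=\mathbb{R}^d\cup\{\infty\}$ with the unit sphere $\mathbb{S}^d\subset\mathbb{E}^{d+1}$ via stereographic projection. For a $(d+1)$-polytope $\mathcal{P}\subset\mathbb{E}^{d+1}$ with all vertices outside $\mathbb{S}^d$, each vertex $v$ determines the spherical cap of points of $\mathbb{S}^d$ visible from $v$; its stereographic image is a $d$-ball $b_v$ (a closed ball, closed ball complement, or closed half-space of $\widehat{\mathbb{R}^d}$), and $\mathsf{B}(\mathcal{P})=\{b_v\}$ is the ball-arrangement projection. $\mathcal{P}$ is edge-scribed if all its edges are tangent to $\mathbb{S}^d$; a polytope is edge-scribable if it has a combinatorially equivalent edge-scribed realization. An edge-scribable $(d+1)$-polytope is Möbius unique if for any two edge-scribed realizations $\mathcal{P}_1,\mathcal{P}_2$ of it, $\mathsf{B}(\mathcal{P}_1)$ and $\mathsf{B}(\mathcal{P}_2)$ are related by a Möbius transformation of $\widehat{\mathbb{R}^d}$ (equivalently, $\mathcal{P}_1$ and $\mathcal{P}_2$ are related by a projective transformation preserving $\mathbb{S}^d$). *)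

(* Defs.v *)
From HB Require Import structures.
From mathcomp Require Import all_boot all_order all_algebra.
From mathcomp Require Import boolp classical_sets functions reals.

Set Implicit Arguments.
Unset Strict Implicit.
Unset Printing Implicit Defensive.

Import Order.TTheory GRing.Theory Num.Theory.

Local Open Scope classical_set_scope.
Local Open Scope ring_scope.

(* The norm that MathComp-Analysis puts on row vectors is the sup norm; all
   metric notions below are Euclidean and go through [dot]. *)
Definition dot (R : realType) (n : nat) (u v : 'rV[R]_n) : R := (u *m v^T) 0 0.

Definition unit_sphere (R : realType) (n : nat) : set 'rV[R]_n :=
  [set x | dot x x = 1].

(** Polytopes and their faces *)

(* Convex hull of the rows of V. *)
Definition hull (R : realType) (m n : nat) (V : 'M[R]_(m, n)) : set 'rV[R]_n :=
  [set x | exists w : 'rV[R]_m,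
     [/\ forall i, 0 <= w 0 i, \sum_i w 0 i = 1 & x = w *m V]].

(* The affine hull of A has dimension k: A contains a point x0 and k further
   points x0 + row i B which form an affine frame of it. *)
Definition has_dim (R : realType) (n : nat) (A : set 'rV[R]_n) (k : nat) : Prop :=
  exists (x0 : 'rV[R]_n) (B : 'M[R]_(k, n)),
    [/\ A x0, row_free B, forall i, A (x0 + row i B)
      & forall x, A x -> (x - x0 <= B)%MS].

Definition polytope (R : realType) (n k : nat) (P : set 'rV[R]_n) : Prop :=
  (exists (m : nat) (V : 'M[R]_(m, n)), P = hull V) /\ has_dim P k.

(* a = 0 is allowed, so that set0 and P itself are faces of P. *)
Definition face (R : realType) (n : nat) (P F : set 'rV[R]_n) : Prop :=
  exists (a : 'rV[R]_n) (c : R),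
    (forall x, P x -> dot a x <= c) /\ F = P `&` [set x | dot a x = c].

Definition vertex (R : realType) (n : nat) (P : set 'rV[R]_n) (v : 'rV[R]_n) :
  Prop := face P [set v].

Definition edge (R : realType) (n : nat) (P E : set 'rV[R]_n) : Prop :=
  face P E /\ has_dim E 1.

(* Isomorphism of face lattices. *)
Definition comb_equiv (R : realType) (m n : nat)
    (P : set 'rV[R]_m) (Q : set 'rV[R]_n) : Prop :=
  exists phi : set 'rV[R]_m -> set 'rV[R]_n,
    set_bij (face P) (face Q) phi /\
    forall F G, face P F -> face P G -> (F `<=` G <-> phi F `<=` phi G).

(* The point of tangency belongs to the edge itself, not just to its line. *)
Definition tangent_to_sphere (R : realType) (n : nat) (E : set 'rV[R]_n) : Prop :=
  exists p, [/\ E p, unit_sphere p & forall x, E x -> dot (x - p) p = 0].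

Definition edge_scribed (R : realType) (n : nat) (P : set 'rV[R]_n) : Prop :=
  [/\ polytope n P, forall v, vertex P v -> 1 < dot v v
    & forall E, edge P E -> tangent_to_sphere E].

Definition edge_scribed_realization (R : realType) (n : nat)
    (P Q : set 'rV[R]_n) : Prop := edge_scribed Q /\ comb_equiv Q P.

Definition edge_scribable (R : realType) (n : nat) (P : set 'rV[R]_n) : Prop :=
  polytope n P /\ exists Q, edge_scribed_realization P Q.

(* The rows of the matrix are the vectors e_i and - e_i. *)
Definition cross_polytope (R : realType) (n : nat) : set 'rV[R]_n :=
  hull (col_mx 1%:M (- 1%:M) : 'M[R]_(n + n, n)).
Arguments cross_polytope : clear implicits.

(** The Moebius space, with [None] as the point at infinity *)

Definition hatR (R : realType) (d : nat) : Type := option 'rV[R]_d.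

Definition inversion (R : realType) (d : nat) (c : 'rV[R]_d) (r : R)
    (x : hatR R d) : hatR R d :=
  match x with
  | None => Some c
  | Some y => if y == c then None
              else Some (c + (r ^+ 2 / dot (y - c) (y - c)) *: (y - c))
  end.

(* Reflection in the hyperplane [dot a y = b]. *)
Definition reflection (R : realType) (d : nat) (a : 'rV[R]_d) (b : R)
    (x : hatR R d) : hatR R d :=
  match x with
  | None => None
  | Some y => Some (y - (2 * (dot a y - b) / dot a a) *: a)
  end.

(* The group generated by inversions in (d-1)-spheres and reflections in
   hyperplanes; the generators are involutions, so no inverses are needed. *)
Inductive moebius (R : realType) (d : nat) : (hatR R d -> hatR R d) -> Prop :=
| moebius_id : moebius id
| moebius_inversion (c : 'rV[R]_d) (r : R) f :
    0 < r -> moebius f -> moebius (inversion c r \o f)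
| moebius_reflection (a : 'rV[R]_d) (b : R) f :
    a != 0 -> moebius f -> moebius (reflection a b \o f).

(* Projection from the north pole, the point whose last coordinate is 1, onto
   the equatorial hyperplane. *)
Definition stereo (R : realType) (d : nat) (x : 'rV[R]_(d + 1)) : hatR R d :=
  let t := rsubmx x 0 0 in
  if t == 1 then None else Some ((1 - t)^-1 *: lsubmx x).

(* The points x of the sphere such that the segment from v to x meets the
   closed unit ball only in x. *)
Definition visible_cap (R : realType) (n : nat) (v : 'rV[R]_n) : set 'rV[R]_n :=
  [set x | unit_sphere x /\
     forall t : R, 0 <= t < 1 ->
       1 < dot (v + t *: (x - v)) (v + t *: (x - v))].

Definition vertex_ball (R : realType) (d : nat) (v : 'rV[R]_(d + 1)) :
  set (hatR R d) := @stereo R d @` visible_cap v.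

Definition ball_arrangement (R : realType) (d : nat) (P : set 'rV[R]_(d + 1)) :
  set (set (hatR R d)) := [set vertex_ball v | v in vertex P].

Definition moebius_equiv (R : realType) (d : nat)
    (B1 B2 : set (set (hatR R d))) : Prop :=
  exists f, moebius f /\ [set f @` b | b in B1] = B2.

Definition moebius_unique (R : realType) (d : nat) (P : set 'rV[R]_(d + 1)) :
  Prop :=
  edge_scribable P /\
  forall P1 P2 : set 'rV[R]_(d + 1),
    edge_scribed_realization P P1 -> edge_scribed_realization P P2 ->
    moebius_equiv (ball_arrangement P1) (ball_arrangement P2).

(* Main.v *)
(**
Send a vertex [v] to the unit spacelike vector proportional to [(v, 1)] in
Lorentz space: [b_v] is cut out of the projectivised light cone by the
half-space of that vector, and an edge [vw] tangent to the sphere means that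
the two vectors have product [-1].  For the cross polytope this gives vectors
[x_i, y_i] (opposite vertices) with all products [-1] except for [<x_i, y_i>].
The differences [z_i = x_i - y_i] are pairwise orthogonal and, as there are at
least three pairs, not null; the sums [x_i + y_i] are orthogonal to all of them,
so they lie on a line, and their mutual products [-4] make them equal to one
vector [s].  Hence [<s, s> = -4], [<z_i, z_i> = 8], and two realizations give
two orthogonal frames with the same Gram matrix.  One frame is carried to the
other by successively reflecting [s], [z_1], [z_2], ... onto their targets; since
[s] is timelike, each mirror normal is spacelike, so each reflection induces an
inversion or a hyperplane reflection of the Moebius space.
*)

Require Import Defs.
From mathcomp Require Import all_boot all_order all_algebra.
From mathcomp Require Import boolp classical_sets functions reals.
From mathcomp Require Import ring lra.

Set Implicit Arguments.
Unset Strict Implicit.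
Unset Printing Implicit Defensive.

Import Order.TTheory GRing.Theory Num.Theory.

Local Open Scope classical_set_scope.
Local Open Scope ring_scope.

(** * The Euclidean inner product *)

Section Dot.
Variables (R : realType) (n : nat).
Implicit Types (u v w : 'rV[R]_n) (k : R).

Lemma dotE u v : dot u v = \sum_i u 0 i * v 0 i.
Proof. by rewrite /dot mxE; apply: eq_bigr => i _; rewrite mxE. Qed.

Lemma dotC u v : dot u v = dot v u.
Proof. by rewrite !dotE; apply: eq_bigr => i _; rewrite mulrC. Qed.

Lemma dotDl u v w : dot (u + v) w = dot u w + dot v w.
Proof. by rewrite /dot mulmxDl mxE. Qed.

Lemma dotZl k u v : dot (k *: u) v = k * dot u v.
Proof. by rewrite /dot -scalemxAl mxE. Qed.

Lemma dotNl u v : dot (- u) v = - dot u v.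
Proof. by rewrite -scaleN1r dotZl mulN1r. Qed.

Lemma dotDr u v w : dot u (v + w) = dot u v + dot u w.
Proof. by rewrite dotC dotDl !(dotC u). Qed.

Lemma dotZr k u v : dot u (k *: v) = k * dot u v.
Proof. by rewrite dotC dotZl dotC. Qed.

Lemma dotNr u v : dot u (- v) = - dot u v.
Proof. by rewrite dotC dotNl dotC. Qed.

Lemma dot0l v : dot 0 v = 0.
Proof. by rewrite -(scale0r 0) dotZl mul0r. Qed.

Lemma dot0r v : dot v 0 = 0.
Proof. by rewrite dotC dot0l. Qed.

Definition dotL := (dotDl, dotDr, dotZl, dotZr, dotNl, dotNr, dot0l, dot0r).

Lemma dot_ge0 u : 0 <= dot u u.
Proof. by rewrite dotE sumr_ge0 // => i _; rewrite -expr2 sqr_ge0. Qed.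

Lemma dot_eq0 u : (dot u u == 0) = (u == 0).
Proof.
apply/eqP/eqP => [|->]; last by rewrite dot0l.
rewrite dotE => /psumr_eq0P H; apply/rowP => i; rewrite mxE.
have /eqP : u 0 i * u 0 i = 0 by apply: H => // j _; rewrite -expr2 sqr_ge0.
by rewrite -expr2 sqrf_eq0 => /eqP.
Qed.

Lemma dot_gt0 u : (0 < dot u u) = (u != 0).
Proof. by rewrite lt_def dot_ge0 andbT dot_eq0. Qed.

Lemma dot_Cauchy_Schwarz u v : dot u v ^+ 2 <= dot u u * dot v v.
Proof.
have [->|v0] := eqVneq v 0; first by rewrite !dot0r mulr0 expr2 mulr0.
have vv : 0 < dot v v by rewrite dot_gt0.
have := dot_ge0 (dot v v *: u - dot u v *: v).
rewrite !dotL (dotC v u) => H.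
by rewrite -subr_ge0 -(pmulr_rge0 _ vv); lra.
Qed.

Lemma dot_mulmxr m u (w : 'rV[R]_m) (V : 'M[R]_(m, n)) :
  dot u (w *m V) = \sum_i w 0 i * dot u (row i V).
Proof.
rewrite dotC /dot -mulmxA mxE; apply: eq_bigr => i _; congr (_ * _).
rewrite mxE -/(dot u (row i V)) dotC dotE; apply: eq_bigr => j _.
by rewrite !mxE.
Qed.

End Dot.

(** * Exposed faces of the convex hull of finitely many points *)

Section HullFaces.
Variables (R : realType) (m n : nat) (V : 'M[R]_(m, n)).
Implicit Types (a b x v : 'rV[R]_n) (c e : R) (F G : set 'rV[R]_n).

Lemma hull_row i : hull V (row i V).
Proof.
exists (delta_mx 0 i); split=> [j||]; last by rewrite rowE.
- by rewrite mxE ler0n.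
- rewrite (bigD1 i) //= big1 ?addr0 => [|j /negPf ji]; rewrite mxE ?eqxx //.
  by rewrite ji andbF.
Qed.

Lemma hull_convex x v (t : R) : hull V x -> hull V v -> 0 <= t <= 1 ->
  hull V (x + t *: (v - x)).
Proof.
move=> [w [w0 w1 ->]] [w' [w'0 w'1 ->]] /andP[t0 t1].
exists (w + t *: (w' - w)); split=> [i||].
- rewrite !mxE; have := w0 i; have := w'0 i; nra.
- under eq_bigr => i _ do rewrite !mxE.
  by rewrite big_split /= -mulr_sumr sumrB w1 w'1 subrr mulr0 addr0.
- by rewrite mulmxDl -scalemxAl mulmxBl.
Qed.

Lemma dot_conv_le b e (w : 'rV[R]_m) : (forall i, 0 <= w 0 i) ->
  \sum_i w 0 i = 1 -> (forall i, w 0 i != 0 -> dot b (row i V) <= e) ->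
  dot b (w *m V) <= e.
Proof.
move=> w0 w1 H; rewrite dot_mulmxr -[e]mul1r -w1 mulr_suml.
apply: ler_sum => i _; have [->|wi] := eqVneq (w 0 i) 0; first by rewrite !mul0r.
by rewrite ler_wpM2l // H.
Qed.

Lemma hull_le b e x : (forall i, dot b (row i V) <= e) -> hull V x ->
  dot b x <= e.
Proof. by move=> H [w [w0 w1 ->]]; apply: dot_conv_le. Qed.

Lemma hull_support a c (w : 'rV[R]_m) : (forall i, 0 <= w 0 i) ->
  \sum_i w 0 i = 1 -> (forall i, dot a (row i V) <= c) ->
  dot a (w *m V) = c -> forall i, w 0 i != 0 -> dot a (row i V) = c.
Proof.
move=> w0 w1 H E.
have /psumr_eq0P S : \sum_i w 0 i * (c - dot a (row i V)) = 0.
  under eq_bigr => i _ do rewrite mulrBr.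
  by rewrite sumrB -dot_mulmxr E -mulr_suml w1 mul1r subrr.
move=> i wi; apply/eqP; rewrite eq_sym -subr_eq0.
have /eqP : w 0 i * (c - dot a (row i V)) = 0.
  by apply: S => // j _; rewrite mulr_ge0 // subr_ge0.
by rewrite mulf_eq0 (negPf wi).
Qed.

Lemma face_rows F x : face (hull V) F -> F x ->
  exists w : 'rV[R]_m, [/\ forall i, 0 <= w 0 i, \sum_i w 0 i = 1,
    x = w *m V & forall i, w 0 i != 0 -> F (row i V)].
Proof.
move=> [a [c [H ->]]] [[w [w0 w1 ->]] /= E]; exists w; split=> // i wi.
split; first exact: hull_row.
by apply: (hull_support w0 w1) => // j; apply: H; apply: hull_row.
Qed.

Lemma face_row F x : face (hull V) F -> F x -> exists i, F (row i V).
Proof.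
move=> fF /(face_rows fF) [w [w0 w1 _ H]]; apply: contrapT => N.
have := w1; rewrite big1 => [/eqP|i _]; first by rewrite eq_sym oner_eq0.
by apply/eqP; apply: contrapT => /negP /H ?; apply: N; exists i.
Qed.

Lemma face_rows_le F b e : face (hull V) F ->
  (forall i, F (row i V) -> dot b (row i V) <= e) ->
  forall x, F x -> dot b x <= e.
Proof.
move=> fF H x /(face_rows fF) [w [w0 w1 -> S]].
by apply: dot_conv_le => // i /S /H.
Qed.

Lemma face_argmax_row F (M : 'I_m -> R) : face (hull V) F -> F !=set0 ->
  exists2 i, F (row i V) & forall j, F (row j V) -> M j <= M i.
Proof.
move=> fF [x /(face_row fF) [i0 Fi0]].
pose P i := `[< F (row i V) >]; have Pi0 : P i0 by apply/asboolP.
case: (@arg_maxP _ _ _ i0 P M Pi0) => i /asboolP Fi Hi; exists i => // j Fj.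
by apply: Hi; apply/asboolP.
Qed.

(* If [b] exposes G in F and [a] exposes F in the polytope, then [M a + b]
   exposes G once M is large compared with the gaps [c - dot a (row i V)]. *)
Lemma face_face F G : face (hull V) F -> face F G -> face (hull V) G.
Proof.
move=> fF [b [e [Hb ->]]]; have := fF => -[a [c [Ha EF]]].
have Hr i : dot a (row i V) <= c by apply: Ha; apply: hull_row.
pose M := \sum_i `|(dot b (row i V) - e) / (c - dot a (row i V))| + 1.
have MP i : dot a (row i V) < c ->
    M * dot a (row i V) + dot b (row i V) < M * c + e.
  move=> Hi; have gi : 0 < c - dot a (row i V) by rewrite subr_gt0.
  have : (dot b (row i V) - e) / (c - dot a (row i V)) < M.
    rewrite /M (bigD1 i) //= -addrA; apply: le_lt_trans (ler_norm _) _.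
    by rewrite ltrDl ltr_wpDl // sumr_ge0.
  rewrite ltr_pdivrMr // => ?; lra.
have FE i : dot a (row i V) = c -> F (row i V).
  by rewrite EF => ?; split=> //; apply: hull_row.
have HM i : dot (M *: a + b) (row i V) <= M * c + e.
  rewrite !dotL; have := Hr i; rewrite le_eqVlt => /orP[/eqP E|/MP/ltW //].
  by rewrite E lerD2l; apply/Hb/FE.
have HE i : dot (M *: a + b) (row i V) = M * c + e -> dot a (row i V) = c.
  rewrite !dotL; have := Hr i; rewrite le_eqVlt => /orP[/eqP //|/MP L E].
  by rewrite E ltxx in L.
exists (M *: a + b), (M * c + e); split; first by move=> x; apply: hull_le.
apply/seteqP; split=> x /=.
- rewrite {1}EF => -[[Px /= Ea] Eb]; split=> //.
  by rewrite !dotL Ea Eb.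
- move=> [Px E]; suff Fx : F x.
    split=> //; move: Fx E; rewrite EF => -[_ /=] Ea.
    by rewrite !dotL Ea => /addrI.
  rewrite EF; split=> //=; case: Px E => w [w0 w1 ->] E.
  have S := hull_support w0 w1 HM E.
  apply/eqP; rewrite eq_le; apply/andP; split.
    by apply: dot_conv_le => // i.
  rewrite -lerN2 -dotNl; apply: dot_conv_le => // i /S /HE Ei.
  by rewrite dotNl Ei.
Qed.

(* The point of F farthest from the origin is exposed. *)
Lemma face_has_vertex F : face (hull V) F -> F !=set0 ->
  exists2 v, vertex (hull V) v & F v.
Proof.
move=> fF nF.
have [i Fi Hi] := face_argmax_row (fun i => dot (row i V) (row i V)) fF nF.
exists (row i V) => //; apply: (face_face fF).
set v := row i V in Fi Hi *.
have cs u : dot u u <= dot v v -> dot v u <= dot v v.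
  by move=> uu; have := dot_ge0 (v - u); rewrite !dotL (dotC u v); lra.
exists v, (dot v v); split.
  by apply: (face_rows_le fF) => j Fj; apply/cs/Hi.
apply/seteqP; split=> [x /= -> //|x /= [Fx E]].
have [w [w0 w1 xE S]] := face_rows fF Fx.
have xv : dot x x <= dot v v.
  rewrite {2}xE; apply: dot_conv_le => // j /S Fj.
  have Hj := Hi j Fj; rewrite dotC.
  have : dot (row j V) x <= dot v v; last by rewrite dotC.
  rewrite xE; apply: dot_conv_le => // k /S Fk.
  have := dot_ge0 (row j V - row k V); have := Hi k Fk.
  by rewrite !dotL (dotC (row k V)); rewrite -/v in Hj *; lra.
apply/eqP; rewrite -subr_eq0 -dot_eq0 eq_le dot_ge0 andbT.
by rewrite !dotL (dotC x v) E; lra.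
Qed.

Lemma vertex_row v : vertex (hull V) v -> exists i, v = row i V.
Proof. by move=> /face_row /(_ (erefl : [set v] v)) [i <-]; exists i. Qed.

(** A nonzero component [u] of [x - v] orthogonal to [w - v] would attain its maximum over [F] at a
    vertex. That vertex is [v] or [w], where [u] takes the same value, yet its value at [x] is
    larger. The case [w = v] is included. *)
Lemma face_two_vertices F v w : face (hull V) F -> F v ->
  (forall u, vertex (hull V) u -> F u -> u = v \/ u = w) ->
  forall x, F x -> exists t, x = v + t *: (w - v).
Proof.
move=> fF Fv H x Fx.
pose t := dot (x - v) (w - v) / dot (w - v) (w - v).
pose u := x - v - t *: (w - v).
have uwv : dot u (w - v) = 0.
  rewrite /u dotDl dotNl dotZl /t; have [E|N] := eqVneq (dot (w - v) (w - v)) 0.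
    by move/eqP: (E); rewrite dot_eq0 => /eqP ->; rewrite !dot0r; ring.
  by rewrite mulfVK // subrr.
have uwE : dot u w = dot u v.
  by apply/eqP; rewrite -subr_eq0 -dotNr -dotDr uwv.
have [u0|u0] := eqVneq u 0.
  by exists t; apply/eqP; rewrite -subr_eq0 -u0 /u opprD addrA.
have [i Fi Hi] := face_argmax_row (fun i => dot u (row i V)) fF (ex_intro _ x Fx).
have Hu := face_rows_le fF Hi.
pose G := F `&` [set y | dot u y = dot u (row i V)].
have fG : face (hull V) G by apply: (face_face fF); exists u, (dot u (row i V)).
have [y vy [Fy /= Ey]] : exists2 y, vertex (hull V) y & G y.
  by apply: (face_has_vertex fG); exists (row i V).
have uy : dot u y = dot u v by case: (H y vy Fy) => ->.
have : dot u v < dot u x.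
  have : 0 < dot u u by rewrite dot_gt0.
  rewrite {2}/u dotDr dotDr !dotNr dotZr uwv; lra.
by rewrite -uy Ey ltNge Hu.
Qed.

End HullFaces.

(** * The Lorentz form and its reflections *)

Section Lorentz.
Variables (R : realType) (n : nat).
Implicit Types (u v w x y : 'rV[R]_(n + 1)) (k : R).

Definition spacepart u : 'rV[R]_n := lsubmx u.
Definition timepart u : R := rsubmx u 0 0.
Definition lor u v : R :=
  dot (spacepart u) (spacepart v) - timepart u * timepart v.

Lemma spacepartD u v : spacepart (u + v) = spacepart u + spacepart v.
Proof. exact: raddfD. Qed.

Lemma spacepartZ k u : spacepart (k *: u) = k *: spacepart u.
Proof. exact: linearZ. Qed.

Lemma timepartD u v : timepart (u + v) = timepart u + timepart v.
Proof. by rewrite /timepart raddfD mxE. Qed.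

Lemma timepartZ k u : timepart (k *: u) = k * timepart u.
Proof. by rewrite /timepart linearZ mxE. Qed.

Lemma lorentz_eq u v : spacepart u = spacepart v -> timepart u = timepart v -> u = v.
Proof.
move=> E1 E2; rewrite -[u]hsubmxK -[v]hsubmxK; congr row_mx => //.
by apply/matrixP => i j; rewrite !ord1.
Qed.

Lemma lorC u v : lor u v = lor v u.
Proof. by rewrite /lor dotC mulrC. Qed.

Lemma lorDl u v w : lor (u + v) w = lor u w + lor v w.
Proof. by rewrite /lor spacepartD timepartD dotDl; ring. Qed.

Lemma lorZl k u v : lor (k *: u) v = k * lor u v.
Proof. by rewrite /lor spacepartZ timepartZ dotZl; ring. Qed.

Lemma lorNl u v : lor (- u) v = - lor u v.
Proof. by rewrite -scaleN1r lorZl mulN1r. Qed.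

Lemma lorDr u v w : lor u (v + w) = lor u v + lor u w.
Proof. by rewrite lorC lorDl !(lorC u). Qed.

Lemma lorZr k u v : lor u (k *: v) = k * lor u v.
Proof. by rewrite lorC lorZl lorC. Qed.

Lemma lorNr u v : lor u (- v) = - lor u v.
Proof. by rewrite lorC lorNl lorC. Qed.

Lemma lor0l v : lor 0 v = 0.
Proof. by rewrite -(scale0r 0) lorZl mul0r. Qed.

Lemma lor_suml (I : finType) (F : I -> 'rV[R]_(n + 1)) v :
  lor (\sum_i F i) v = \sum_i lor (F i) v.
Proof.
by elim/big_rec2: _ => [|i a b _ <-]; rewrite ?lor0l ?lorDl.
Qed.

Definition lorL := (lorDl, lorDr, lorZl, lorZr, lorNl, lorNr).


Lemma timelike_orthogonal_gt0 u w : lor u u < 0 -> lor w u = 0 -> w != 0 ->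
  0 < lor w w.
Proof.
move=> uu /eqP; rewrite /lor subr_eq0 => /eqP wu w0; rewrite subr_gt0 -expr2.
have := dot_Cauchy_Schwarz (spacepart w) (spacepart u); rewrite wu exprMn => cs.
have uu' : dot (spacepart u) (spacepart u) < timepart u ^+ 2.
  by rewrite -subr_lt0 expr2.
have [s0|s0] := eqVneq (timepart w) 0.
  rewrite s0 expr0n /= dot_gt0; apply: contraNneq w0 => w0.
  apply/eqP/lorentz_eq; first by rewrite w0 /spacepart linear0.
  by rewrite s0 /timepart linear0 mxE.
have s2 : 0 < timepart w ^+ 2 by rewrite exprn_even_gt0.
have a0 := dot_ge0 (spacepart w); have b0 := dot_ge0 (spacepart u).
move: (dot (spacepart w) _) (dot (spacepart u) _) (timepart w ^+ 2) (timepart u ^+ 2)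
  a0 b0 s2 uu' cs => a b s t a0 b0 s2 bt cs.
rewrite ltNge; apply/negP => as_; nra.
Qed.

Lemma future_timelike_lt0 u v : lor u u < 0 -> lor v v < 0 ->
  0 < timepart u -> 0 < timepart v -> lor u v < 0.
Proof.
rewrite /lor !subr_lt0 => uu vv u0 v0.
have := dot_Cauchy_Schwarz (spacepart u) (spacepart v).
have := dot_ge0 (spacepart u); have := dot_ge0 (spacepart v).
move: (dot (spacepart u) (spacepart v)) (dot (spacepart v) _) (dot (spacepart u) _)
  uu vv => a b c.
move: (timepart u) (timepart v) u0 v0 => s t s0 t0 cs bt b0 c0 H.
rewrite ltNge; apply/negP => st.
have st0 : 0 < s * t by rewrite mulr_gt0.
have : (s * t) ^+ 2 <= a ^+ 2 by rewrite lerXn2r // nnegrE; lra.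
have : c * b <= (s * s) * b by rewrite ler_wpM2r // ltW.
have : (s * s) * b < (s * s) * (t * t) by rewrite ltr_pM2l // mulr_gt0.
lra.
Qed.

(** After rescaling to equal time parts, the difference is null with time part zero, so its space
    part has Euclidean square zero. *)
Lemma null_orthogonal_proportional p z : lor p p = 0 -> lor z z = 0 ->
  lor p z = 0 -> timepart p != 0 -> z = (timepart z / timepart p) *: p.
Proof.
rewrite /lor => /eqP + /eqP + /eqP; rewrite !subr_eq0.
move=> /eqP pp /eqP zz /eqP pz p0.
apply: lorentz_eq; last by rewrite timepartZ mulfVK.
rewrite spacepartZ; apply/eqP; rewrite -subr_eq0 -dot_eq0 !dotL.
by rewrite (dotC (spacepart z) (spacepart p)) pp zz pz; apply/eqP; field.
Qed.

(** Reflection in the Lorentz-orthogonal complement of [u]. For null [u] the division by zero makes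
    it the identity. *)
Definition refl u v := v - (2 * lor v u / lor u u) *: u.

Lemma reflD u v w : refl u (v + w) = refl u v + refl u w.
Proof.
by rewrite /refl lorDl mulrDr mulrDl scalerDl opprD addrACA.
Qed.

Lemma reflZ u k v : refl u (k *: v) = k *: refl u v.
Proof.
by rewrite /refl lorZl scalerBr scalerA; congr (_ - _ *: _); ring.
Qed.

Lemma refl_scale u k v : k != 0 -> refl (k *: u) v = refl u v.
Proof.
move=> k0; rewrite /refl !lorL scalerA; congr (_ - _ *: _).
have [->|u0] := eqVneq (lor u u) 0; first by rewrite !mulr0 invr0 !mulr0 mul0r.
by field; rewrite k0 u0.
Qed.

Lemma refl_selfadjoint u v w : lor (refl u v) w = lor v (refl u w).
Proof. by rewrite /refl !lorL (lorC u w); ring. Qed.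

Lemma reflK u v : lor u u != 0 -> refl u (refl u v) = v.
Proof.
move=> u0; rewrite [LHS]/refl {1}/refl -addrA -opprD -scalerDl.
rewrite (_ : (_ + _ : R) = 0) ?scale0r ?subr0 //.
by rewrite /refl !lorL; field.
Qed.

Lemma refl_isometry u v w : lor u u != 0 ->
  lor (refl u v) (refl u w) = lor v w.
Proof. by move=> u0; rewrite refl_selfadjoint reflK. Qed.

(** Equal squares give [lor (v - w) (v - w) = 2 * lor v (v - w)], so the coefficient in [refl] is
    1. *)
Lemma refl_swap v w : lor v v = lor w w -> lor (v - w) (v - w) != 0 ->
  refl (v - w) v = w.
Proof.
move=> E N; rewrite /refl (_ : 2 * _ / _ = 1) ?scale1r ?subKr //.
move: N; rewrite !lorL (lorC w v) -E => N; field.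
by move: N; apply: contra_neq => <-; ring.
Qed.

Lemma refl_fix u v : lor v u = 0 -> refl u v = v.
Proof. by move=> E; rewrite /refl E mulr0 mul0r scale0r subr0. Qed.

End Lorentz.

(** * Null lifts of points of the Moebius space *)

Section NullLift.
Variables (R : realType) (d : nat).
Implicit Types (a y : 'rV[R]_d) (b c k : R) (p : hatR R d)
  (u X : 'rV[R]_(d + 1 + 1)).

Definition lvec a b c : 'rV[R]_(d + 1 + 1) :=
  row_mx (row_mx a (const_mx b)) (const_mx c).

Lemma lvecP X : exists a b c, X = lvec a b c.
Proof.
exists (lsubmx (lsubmx X)), (rsubmx (lsubmx X) 0 0), (rsubmx X 0 0).
rewrite /lvec -[LHS]hsubmxK; congr row_mx; last first.
  by apply/matrixP => i j; rewrite !ord1 !mxE.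
rewrite -[LHS]hsubmxK; congr row_mx.
by apply/matrixP => i j; rewrite !ord1 !mxE.
Qed.

Lemma lvec_inj a b c a' b' c' : lvec a b c = lvec a' b' c' ->
  [/\ a = a', b = b' & c = c'].
Proof.
move=> /eq_row_mx[/eq_row_mx[-> /matrixP/(_ 0 0)] + /matrixP/(_ 0 0)].
by rewrite !mxE.
Qed.

Lemma lvecD a b c a' b' c' :
  lvec a b c + lvec a' b' c' = lvec (a + a') (b + b') (c + c').
Proof.
rewrite /lvec !add_row_mx; congr (row_mx (row_mx _ _) _);
  by apply/matrixP => i j; rewrite !mxE.
Qed.

Lemma lvecZ k a b c : k *: lvec a b c = lvec (k *: a) (k * b) (k * c).
Proof.
rewrite /lvec !scale_row_mx; congr (row_mx (row_mx _ _) _);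
  by apply/matrixP => i j; rewrite !mxE.
Qed.

Lemma lvecN a b c : - lvec a b c = lvec (- a) (- b) (- c).
Proof. by rewrite -scaleN1r lvecZ scaleN1r !mulN1r. Qed.

Lemma dot_row_mx1 a b a' b' :
  dot (row_mx a (const_mx b) : 'rV_(d + 1)) (row_mx a' (const_mx b')) =
  dot a a' + b * b'.
Proof.
rewrite !dotE big_split_ord big_ord1 /=; congr (_ + _).
  by apply: eq_bigr => i _; rewrite !row_mxEl.
by rewrite !row_mxEr !mxE.
Qed.

Lemma lor_lvec a b c a' b' c' :
  lor (lvec a b c) (lvec a' b' c') = dot a a' + b * b' - c * c'.
Proof.
rewrite /lor /spacepart /timepart /lvec !row_mxKl !row_mxKr dot_row_mx1.
by rewrite !mxE.
Qed.

(** A null vector over the point of the sphere that projects to [p], with the denominators of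
    inverse stereographic projection cleared; [None] lifts to the north pole. *)
Definition null_lift p : 'rV[R]_(d + 1 + 1) :=
  match p with
  | None => lvec 0 1 1
  | Some y => lvec (2 *: y) (dot y y - 1) (dot y y + 1)
  end.

(** The last coordinate minus the one before it is 2 on finite lifts and 0 at infinity. This
    separates infinity and forces [k = 1] between finite points. *)
Lemma null_lift_inj p q k : 0 < k -> null_lift p = k *: null_lift q -> p = q.
Proof.
move=> k0; case: p q => [y|] [y'|] //=; rewrite lvecZ => /lvec_inj[].
- move=> E1 E2 E3; have k1 : k = 1 by lra.
  move: E1; rewrite k1 scale1r => /scalerI -> //.
  by rewrite pnatr_eq0.
- by move=> _ E2 E3; exfalso; lra.
- by move=> _ E2 E3; exfalso; lra.
Qed.

(** For spacelike [X] this is a closed ball, the complement of an open ball, or a closed half-space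
    with infinity. *)
Definition lball X : set (hatR R d) := [set p | 0 <= lor (null_lift p) X].

Lemma lball_scale k X : 0 < k -> lball (k *: X) = lball X.
Proof.
by move=> k0; apply/seteqP; split=> p; rewrite /lball /= lorZr pmulr_rge0.
Qed.

(* The spacelike vector [lvec (- o) ((m + 1) / 2) ((m - 1) / 2)] is normal to
   the sphere of center o and squared radius [dot o o + m]. *)
Lemma spacelike_reflection_moebius u : 0 < lor u u ->
  exists g : hatR R d -> hatR R d,
    (forall f, moebius f -> moebius (g \o f)) /\
    forall p, exists2 k, 0 < k & null_lift (g p) = k *: refl u (null_lift p).
Proof.
have [a [b [c ->]]] := lvecP u; rewrite lor_lvec => uu.
have [bc|bc] := eqVneq b c.
  (* The mirror passes through infinity: it is the hyperplane [dot a y = b]. *)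
  have aa : 0 < dot a a by move: uu; rewrite bc; lra.
  have aa0 : dot a a != 0 by rewrite gt_eqF.
  exists (reflection a b); split.
    by move=> f; apply: moebius_reflection; rewrite -dot_gt0.
  move=> p; exists 1 => //; rewrite scale1r -bc; case: p => [y|] /=; last first.
    by rewrite refl_fix // lor_lvec dot0l; ring.
  rewrite /refl !lor_lvec lvecZ lvecN lvecD !dotL (dotC y a).
  congr lvec; try by field; rewrite gt_eqF; lra.
  rewrite scalerBr scalerA; congr (_ - _ *: _); field.
  by rewrite gt_eqF; lra.
have bc0 : b - c != 0 by rewrite subr_eq0.
pose o := - (b - c)^-1 *: a; pose m := (b + c) / (b - c).
have -> : lvec a b c = (b - c) *: lvec (- o) ((m + 1) / 2) ((m - 1) / 2).
  rewrite lvecZ /o /m; congr lvec; try by field.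
  by rewrite scaleNr opprK scalerA divff ?scale1r.
have r2 : 0 < dot o o + m.
  have -> : dot o o + m = (dot a a + b * b - c * c) / (b - c) ^+ 2.
    by rewrite /o /m !dotL; field.
  by rewrite divr_gt0 // exprn_even_gt0.
have [r r0 rE] : exists2 r, 0 < r & r ^+ 2 = dot o o + m.
  by exists (Num.sqrt (dot o o + m)); rewrite ?sqrtr_gt0 // sqr_sqrtr // ltW.
exists (inversion o r); split; first by move=> f; apply: moebius_inversion.
move=> p; rewrite refl_scale //; move: (o) (m) r2 rE => {o m uu bc bc0} o m r2 rE.
have r20 : dot o o + m != 0 by rewrite gt_eqF.
have oo : dot (- o) (- o) + (m + 1) / 2 * ((m + 1) / 2) -
    (m - 1) / 2 * ((m - 1) / 2) = dot o o + m by rewrite !dotL; field.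
case: p => [y|] /=.
  case: eqVneq => [->|yo].
    exists (dot o o + m)^-1; first by rewrite invr_gt0.
    rewrite /refl !lor_lvec oo lvecZ lvecN lvecD lvecZ !dotL; congr lvec.
    - by apply/rowP => i; rewrite !mxE; field.
    - by field.
    - by field.
  have D0 : 0 < dot (y - o) (y - o) by rewrite dot_gt0 subr_eq0.
  have D1 : dot (y - o) (y - o) != 0 by rewrite gt_eqF.
  (* This factor restores the difference 2 between the last two coordinates of a finite lift. *)
  exists (r ^+ 2 / dot (y - o) (y - o)); first by rewrite rE divr_gt0.
  rewrite /= rE /refl !lor_lvec oo lvecZ lvecN lvecD lvecZ.
  move: D1; rewrite !dotL (dotC o y) => D1; congr lvec.
  - by apply/rowP => i; rewrite !mxE; field; rewrite r20.
  - by field; rewrite r20.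
  - by field; rewrite r20.
exists (dot o o + m) => //.
rewrite /refl !lor_lvec oo lvecZ lvecN lvecD lvecZ !dotL; congr lvec.
- by apply/rowP => i; rewrite !mxE; field.
- by field.
- by field.
Qed.

(** Lifts determine points up to positive factors, so [g] is an involution like [refl u];
    self-adjointness then moves the reflection from the lift to [X]. *)
Lemma moebius_reflection_lball u : 0 < lor u u ->
  exists g : hatR R d -> hatR R d,
    (forall f, moebius f -> moebius (g \o f)) /\
    forall X, g @` lball X = lball (refl u X).
Proof.
move=> uu; have uu0 : lor u u != 0 by rewrite gt_eqF.
have [g [mg Hg]] := spacelike_reflection_moebius uu; exists g; split=> // X.
have gK : involutive g.
  move=> p; have [k k0 E] := Hg p; have [k' k'0 E'] := Hg (g p).
  apply: (@null_lift_inj _ _ (k' * k)); first by rewrite mulr_gt0.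
  by rewrite E' E reflZ reflK // scalerA.
have gB p Y : lball Y (g p) <-> lball (refl u Y) p.
  have [k k0 E] := Hg p.
  by rewrite /lball /= E lorZl pmulr_rge0 // refl_selfadjoint.
apply/seteqP; split=> [p [q Xq <-]|p].
  by apply/gB; rewrite reflK.
by move/gB => Xp; exists (g p).
Qed.

End NullLift.

(** * Gram matrices of octahedral systems *)

Lemma ord_two_others n (i : 'I_n) : (2 < n)%N ->
  exists j k, [/\ j != i, k != i & j != k].
Proof.
move=> n2; have /card_gt1P [j [k [ji ki jk]]] : (1 < #|predC1 i|)%N.
  by rewrite cardC1 card_ord -ltnS prednK // (ltn_trans _ n2).
by exists j, k.
Qed.

Section Octahedral.
Variables (R : realType) (n : nat).
Hypothesis n_gt2 : (2 < n)%N.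

(* [X true i] and [X false i] are the normalised Lorentz vectors of the i-th
   pair of opposite vertices; nothing is assumed on their product. *)
Definition octahedral (X : bool -> 'I_n -> 'rV[R]_(n + 1)) : Prop :=
  [/\ forall b i, lor (X b i) (X b i) = 1,
      forall b c i j, i != j -> lor (X b i) (X c j) = -1,
      forall b i, 0 < timepart (X b i)
    & forall i, X true i != X false i].

Variable X : bool -> 'I_n -> 'rV[R]_(n + 1).
Hypothesis octX : octahedral X.
Let X1 : forall b i, lor (X b i) (X b i) = 1 := let: And4 h _ _ _ := octX in h.
Let XN : forall b c i j, i != j -> lor (X b i) (X c j) = -1 :=
  let: And4 _ h _ _ := octX in h.
Let XT : forall b i, 0 < timepart (X b i) := let: And4 _ _ h _ := octX in h.
Let XD : forall i, X true i != X false i := let: And4 _ _ _ h := octX in h.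

Let z i := X true i - X false i.
Let s i := X true i + X false i.

Lemma lor_diff_orth i j : i != j -> lor (z i) (z j) = 0.
Proof. by move=> ij; rewrite /z !lorL !XN //; ring. Qed.

Lemma lor_sum_diff i j : lor (s i) (z j) = 0.
Proof.
rewrite /z /s !lorL; have [->|ij] := eqVneq i j; last by rewrite !XN //; ring.
by rewrite !X1 (lorC (X false j)); ring.
Qed.

Lemma lor_sum_sum i j : i != j -> lor (s i) (s j) = -4.
Proof. by move=> ij; rewrite /s !lorL !XN //; ring. Qed.

Lemma lor_diff_diff i : lor (z i) (z i) = 2 - 2 * lor (X true i) (X false i).
Proof. by rewrite /z !lorL !X1 (lorC (X false i)); ring. Qed.

Lemma lor_sumE i : lor (s i) (s i) = 2 + 2 * lor (X true i) (X false i).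
Proof. by rewrite /s !lorL !X1 (lorC (X false i)); ring. Qed.

(** The vector [X b j + X c k] is null, since 1 + 1 - 2 = 0, and orthogonal to [z i]. Orthogonal
    null vectors are proportional, and [l] is nonzero because [z i] is. *)
Lemma null_diff_proportional i j k b c : j != i -> k != i -> j != k ->
  lor (z i) (z i) = 0 -> exists2 l, l != 0 & z i = l *: (X b j + X c k).
Proof.
move=> ji ki jk zz; set p := X b j + X c k.
have E : z i = (timepart (z i) / timepart p) *: p.
  apply: null_orthogonal_proportional => //.
  - by rewrite /p !lorL !X1 (lorC (X c k)) !XN //; ring.
  - by rewrite /p /z !lorL !XN //; ring.
  - by rewrite gt_eqF // timepartD addr_gt0.
exists (timepart (z i) / timepart p) => //; apply: contraNneq (XD i) => l0.
by rewrite -subr_eq0 -/(z i) E l0 scale0r.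
Qed.

(* A null [z i] would force, by proportionality of orthogonal null vectors,
   [z k] to be null as well, although [z i] and [z k] are then proportional to
   two null vectors that are not orthogonal. *)
Lemma lor_diff_neq0 i : lor (z i) (z i) != 0.
Proof.
apply/eqP => zi; have [j [k [ji ki jk]]] := ord_two_others i n_gt2.
have [l l0 El] := null_diff_proportional true true ji ki jk zi.
have [l' l'0 El'] := null_diff_proportional true false ji ki jk zi.
(* The two null directions just found have product zero, that is [1 - 1 - 1 + lor (X true k) (X
   false k) = 0]. *)
have c1 : lor (X true k) (X false k) = 1.
  move: zi; rewrite {1}El El' lorZl lorZr => /eqP.
  rewrite !mulf_eq0 (negPf l0) (negPf l'0) /= => /eqP.
  rewrite !lorL X1 (lorC (X true k) (X true j)) !(XN _ _ jk).
  by move=> {El El'} ?; lra.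
have zk : lor (z k) (z k) = 0 by rewrite lor_diff_diff c1; ring.
have [ik ij] : i != k /\ i != j by rewrite !(eq_sym i).
have [m m0 Em] := null_diff_proportional true true ik jk ij zk.
have := lor_diff_orth ki; rewrite El Em lorZl lorZr => /eqP.
rewrite !mulf_eq0 (negPf l0) (negPf m0) /= => /eqP.
by rewrite !lorL X1 !XN // 1?eq_sym // => {El El' Em} ?; lra.
Qed.

(** The [n] differences together with [s i] and [s j] are [n + 2] vectors in dimension [n + 1],
    hence dependent. Pairing with [z k] kills the coefficients of the differences, so [s i] and
    [s j] are proportional; both have product -4 with a third sum, so the factor is 1. *)
Lemma sum_eq i j : s i = s j.
Proof.
have [->//|ij] := eqVneq i j.
pose Z := \matrix_l z l.
pose M := col_mx Z (col_mx (s i) (s j)).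
have : kermx M != 0.
  rewrite kermx_eq0 /row_free; apply: contraL (rank_leq_col M) => /eqP ->.
  by rewrite -ltnNge addn1 addn2.
case/rowV0Pn => w /sub_kermxP wM w0.
pose w1 : 'rV_n := lsubmx w; pose a := lsubmx (rsubmx w) 0 0.
pose b := rsubmx (rsubmx w) 0 0.
have wE : w = row_mx w1 (row_mx a%:M b%:M).
  rewrite -[LHS]hsubmxK; congr row_mx; rewrite -[LHS]hsubmxK /a /b.
  by rewrite -!mx11_scalar.
have E : \sum_l w1 0 l *: z l + (a *: s i + b *: s j) = 0.
  move: wM; rewrite wE /M !mul_row_col !mul_scalar_mx mulmx_sum_row.
  by under eq_bigr => l _ do rewrite rowK.
have w10 : w1 = 0.
  apply/rowP => k; rewrite [RHS]mxE; apply/eqP.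
  have := congr1 (fun v => lor v (z k)) E.
  rewrite lorDl lor_suml (bigD1 k) //= big1 => [|l lk]; last first.
    by rewrite lorZl lor_diff_orth // mulr0.
  rewrite lor0l lorDl !lorZl !lor_sum_diff !mulr0 !addr0 => /eqP.
  by rewrite mulf_eq0 (negPf (lor_diff_neq0 k)) orbF.
have sT l : 0 < timepart (s l) by rewrite timepartD addr_gt0.
have {}E : a *: s i + b *: s j = 0.
  by move: E; rewrite w10 big1 ?add0r // => l _; rewrite mxE scale0r.
have tE : a * timepart (s i) + b * timepart (s j) = 0.
  have := congr1 (@timepart _ _) E.
  by rewrite timepartD !timepartZ {3}/timepart linear0 mxE.
have a0 : a != 0.
  apply: contra_neq w0 => a0; rewrite wE w10 a0.
  move/eqP: tE; rewrite a0 mul0r add0r mulf_eq0 (gt_eqF (sT j)) orbF => /eqP ->.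
  by rewrite !raddf0 !row_mx0.
have {}E : s i = (- b / a) *: s j.
  apply: (scalerI a0); rewrite scalerA (_ : a * _ = - b); last by field.
  by apply/eqP; rewrite scaleNr -addr_eq0 E.
have [k [ki kj]] : exists k, k != i /\ k != j.
  have [k [l [ki li kl]]] := ord_two_others i n_gt2.
  have [kj|kj] := eqVneq k j; last by exists k.
  by exists l; rewrite li eq_sym -kj kl.
have := lor_sum_sum ki; rewrite E lorZr lor_sum_sum // => kE.
have n4 : (-4 : R) != 0 by rewrite oppr_eq0 pnatr_eq0.
by rewrite (_ : - b / a = 1) ?scale1r //; apply: (mulIf n4); rewrite mul1r.
Qed.

(** Once all sums agree, [lor (s i) (s i)] is a mixed product, hence -4. As
    [lor (s i) (s i) + lor (z i) (z i) = 4], the differences have square 8. *)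
Lemma octahedral_frame : exists s0 : 'rV[R]_(n + 1),
  [/\ forall i, s i = s0, lor s0 s0 = -4, 0 < timepart s0,
      forall i, lor s0 (z i) = 0
    & forall i j, lor (z i) (z j) = if i == j then 8 else 0].
Proof.
pose i0 : 'I_n := Ordinal (ltn_trans (isT : (0 < 2)%N) n_gt2).
have [j [_ [ji _ _]]] := ord_two_others i0 n_gt2.
have ss i : lor (s i) (s i) = -4.
  by rewrite (sum_eq i i0) {1}(sum_eq i0 j) lor_sum_sum.
exists (s i0); split=> // [i||i|i k]; first exact: sum_eq.
- by rewrite timepartD addr_gt0.
- exact: lor_sum_diff.
- case: eqVneq => [<-|ik]; last exact: lor_diff_orth.
  by have := ss i; rewrite lor_sumE lor_diff_diff; lra.
Qed.

End Octahedral.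

(** * Transport of octahedral systems by Moebius transformations *)

Section Transport.
Variables (R : realType) (d : nat).
Implicit Types (f : hatR R d -> hatR R d) (u v w : 'rV[R]_(d + 1 + 1)).

(** Couples a Möbius map with a linear Lorentz isometry inducing its action on balls, so that it
    suffices to follow vectors. *)
Definition moebius_lift f (L : 'rV[R]_(d + 1 + 1) -> 'rV[R]_(d + 1 + 1)) :=
  [/\ moebius f, forall v, f @` lball v = lball (L v),
      forall u v, L (u + v) = L u + L v, forall k v, L (k *: v) = k *: L v
    & forall u v, lor (L u) (L v) = lor u v].

Lemma moebius_lift_id : moebius_lift id id.
Proof. by split=> // [|v]; [exact: moebius_id | rewrite image_id]. Qed.

(** A further reflection with normal [L e - e'] takes [L e] to [e'] and fixes everything orthogonal
    to the normal; if [L e = e'] already, nothing is added. *)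
Lemma moebius_lift_move f L e e' : moebius_lift f L -> lor e e = lor e' e' ->
  (L e - e' != 0 -> 0 < lor (L e - e') (L e - e')) ->
  exists f' L', [/\ moebius_lift f' L', L' e = e'
    & forall v, lor (L v) (L e - e') = 0 -> L' v = L v].
Proof.
move=> mL ee pos; have [E|N] := eqVneq (L e - e') 0.
  by exists f, L; split=> //; apply/eqP; rewrite -subr_eq0 E.
have uu := pos N; have uu0 := lt0r_neq0 uu.
have [g [mg Hg]] := moebius_reflection_lball uu.
have [mf Lb LD LZ Li] := mL.
exists (g \o f), (refl (L e - e') \o L); split.
- split=> [|v|u v|k v|u v] /=; first exact: mg.
  + by rewrite -Hg -Lb image_comp.
  + by rewrite LD reflD.
  + by rewrite LZ reflZ.
  + by rewrite refl_isometry.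
- by rewrite /= refl_swap // Li.
- by move=> v E; rewrite /= refl_fix.
Qed.

Lemma octahedral_transport (X X' : bool -> 'I_(d + 1) -> 'rV[R]_(d + 1 + 1)) :
  (2 <= d)%N -> octahedral X -> octahedral X' ->
  exists2 f, moebius f & forall b i, f @` lball (X b i) = lball (X' b i).
Proof.
move=> d2 oX oX'; have n2 : (2 < d + 1)%N by rewrite addn1.
have [s [sE ss st sz zz]] := octahedral_frame n2 oX.
have [s' [sE' ss' st' sz' zz']] := octahedral_frame n2 oX'.
pose z i := X true i - X false i; pose z' i := X' true i - X' false i.
have frame k : (k <= d + 1)%N -> exists f L, [/\ moebius_lift f L, L s = s'
    & forall i : 'I_(d + 1), (i < k)%N -> L (z i) = z' i].
  elim: k => [_|k IH kd].
    have [||f [L [mL Ls _]]] := @moebius_lift_move _ _ s s' moebius_lift_id.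
    - by rewrite ss ss'.
    (* Future timelike vectors have negative product, so [s + s'] is timelike; it is orthogonal to
       [s - s']. *)
    - apply: (@timelike_orthogonal_gt0 _ _ (s + s')).
        have : lor s s' < 0 by apply: future_timelike_lt0; rewrite ?ss ?ss'; lra.
        by rewrite !lorL ss ss' (lorC s' s); lra.
      by rewrite !lorL ss ss' (lorC s' s); ring.
    by exists f, L.
  have [f [L [mL Ls Lz]]] := IH (ltnW kd).
  pose o : 'I_(d + 1) := Ordinal kd.
  have [_ _ _ _ Li] := mL.
  have [||f' [L' [mL' Lo Lfix]]] := @moebius_lift_move _ _ (z o) (z' o) mL.
  - by rewrite zz zz'.
  (* Both [L (z o)] and [z' o] are orthogonal to the timelike [s'], hence so is the mirror
     normal. *)
  - apply: (@timelike_orthogonal_gt0 _ _ s'); first by rewrite ss'; lra.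
    by rewrite lorDl lorNl -{1}Ls Li (lorC (z o)) (lorC (z' o)) sz sz' subrr.
  (* The vectors already placed are orthogonal to the new normal, so they stay in place. *)
  exists f', L'; split=> //.
    by rewrite Lfix // lorDr lorNr Li Ls sz sz' subrr.
  move=> i; rewrite ltnS leq_eqVlt => /orP[/eqP ik|ik].
    by rewrite (_ : i = o) //; apply: val_inj.
  have io : i != o by apply: contraTneq ik => ->; rewrite ltnn.
  by rewrite Lfix Lz // lorDr lorNr -(Lz i) // Li zz Lz // zz' (negPf io) subrr.
have [f [L [mL Ls Lz]]] := frame _ (leqnn _).
have [mf Lb LD LZ Li] := mL; exists f => // b i; rewrite Lb; congr lball.
(* Each vector is half the sum plus or minus half the difference of its pair, so the frame
   determines it. *)
have XE (Y : bool -> 'I_(d + 1) -> 'rV[R]_(d + 1 + 1)) :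
    Y b i = 2^-1 *: ((Y true i + Y false i) +
                     (-1) ^+ (~~ b) *: (Y true i - Y false i)).
  by case: b; apply/rowP => k; rewrite !mxE /=; field.
by rewrite (XE X) (XE X') LZ LD LZ sE sE' Ls -/(z i) Lz.
Qed.

End Transport.

(** * Lorentz vectors of vertices *)

Section VertexVector.
Variables (R : realType) (n : nat).
Implicit Types (u v w x p : 'rV[R]_n) (E : set 'rV[R]_n).

Definition homog v : 'rV[R]_(n + 1) := row_mx v (const_mx 1).

Definition nvec v := (Num.sqrt (dot v v - 1))^-1 *: homog v.

Lemma lor_homog v w : lor (homog v) (homog w) = dot v w - 1.
Proof.
by rewrite /lor /spacepart /timepart /homog !row_mxKl !row_mxKr !mxE mulr1.
Qed.

Lemma timepart_homog v : timepart (homog v) = 1.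
Proof. by rewrite /timepart /homog row_mxKr mxE. Qed.

Lemma timepart_nvec_gt0 v : 1 < dot v v -> 0 < timepart (nvec v).
Proof.
by move=> v1; rewrite timepartZ timepart_homog mulr1 invr_gt0 sqrtr_gt0 subr_gt0.
Qed.

Lemma lor_nvec_nvec v : 1 < dot v v -> lor (nvec v) (nvec v) = 1.
Proof.
move=> v1; have s0 : 0 < dot v v - 1 by rewrite subr_gt0.
rewrite /nvec lorZl lorZr lor_homog mulrA -invfM -expr2 sqr_sqrtr ?ltW //.
by rewrite mulVf // gt_eqF.
Qed.

Lemma nvec_inj v w : 1 < dot v v -> 1 < dot w w -> nvec v = nvec w -> v = w.
Proof.
move=> v1 w1 E; have := congr1 (@timepart _ _) E.
rewrite !timepartZ !timepart_homog !mulr1 => E'; move: E; rewrite /nvec E'.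
move=> /scalerI; rewrite invr_eq0 gt_eqF ?sqrtr_gt0 ?subr_gt0 //.
by move=> /(_ isT) /eq_row_mx[].
Qed.

(** Tangency gives [dot v w - 1 = dot (v - p) (w - p)], and likewise for the squares. As [v - p] and
    [w - p] are the multiples [- t] and [1 - t] of [w - v], normalisation leaves only a sign,
    negative because [t] lies between 0 and 1. *)
Lemma lor_nvec_tangent v w p t : 1 < dot v v -> 1 < dot w w ->
  0 <= t <= 1 -> p = v + t *: (w - v) -> dot p p = 1 ->
  dot (v - p) p = 0 -> dot (w - p) p = 0 -> lor (nvec v) (nvec w) = -1.
Proof.
move=> v1 w1 /andP[t0 t1] pE pp vp wp; set D := dot (w - v) (w - v).
have vpE : v - p = - t *: (w - v) by rewrite pE opprD addNKr scaleNr.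
have wpE : w - p = (1 - t) *: (w - v).
  by rewrite pE scalerBl scale1r opprD addrA.
have vpp : dot v p = 1 by move: vp; rewrite !dotL pp; lra.
have wpp : dot w p = 1 by move: wp; rewrite !dotL pp; lra.
have P a b : dot a p = 1 -> dot b p = 1 -> dot a b - 1 = dot (a - p) (b - p).
  by move=> Ea Eb; rewrite !dotL (dotC p b) Ea Eb pp; ring.
have vv : dot v v - 1 = t ^+ 2 * D by rewrite P // vpE !dotZl !dotZr /D; ring.
have ww : dot w w - 1 = (1 - t) ^+ 2 * D.
  by rewrite P // wpE !dotZl !dotZr /D; ring.
have vw : dot v w - 1 = - (t * (1 - t)) * D.
  by rewrite P // vpE wpE !dotZl !dotZr /D; ring.
have D0 : 0 <= D := dot_ge0 _.
have v0 : t ^+ 2 * D != 0 by rewrite -vv gt_eqF // subr_gt0.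
have w0 : (1 - t) ^+ 2 * D != 0 by rewrite -ww gt_eqF // subr_gt0.
move: v0; rewrite mulf_eq0 negb_or sqrf_eq0 => /andP[tn0 Dn0].
move: w0; rewrite mulf_eq0 negb_or sqrf_eq0 => /andP[tn1 _].
rewrite /nvec lorZl lorZr lor_homog vv ww vw (sqrtrM _ (sqr_ge0 t)).
rewrite (sqrtrM _ (sqr_ge0 (1 - t))) !sqrtr_sqr.
rewrite !ger0_norm ?subr_ge0 // -[X in - (t * (1 - t)) * X](sqr_sqrtr D0).
by field; rewrite tn0 tn1 sqrtr_eq0 -ltNge lt_def Dn0 D0.
Qed.

(** At [x + q *: (v - x)], with [q = 1 - t], the squared norm minus 1 is [q * (2 * (dot x v - 1) + q
    * dot (v - x) (v - x))]. *)
Lemma visible_capE v : 1 < dot v v ->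
  visible_cap v = [set x | unit_sphere x /\ 1 <= dot x v].
Proof.
move=> v1; apply/seteqP; split=> x /= [x1 H]; split=> //; last first.
  move=> t /andP[t0 t1]; move: x1; rewrite /unit_sphere /= => x1.
  have vx : 0 < dot (v - x) (v - x).
    rewrite dot_gt0 subr_eq0; apply: contraTneq v1 => ->.
    by rewrite x1 ltxx.
  move: vx; rewrite !dotL x1 (dotC v x) => vx.
  have s0 : 0 < 1 - t by lra.
  have : 0 < (1 - t) * (2 * (dot x v - 1) + (1 - t) * (dot v v - 2 * dot x v + 1)).
    apply: mulr_gt0 => //; have : 0 < (1 - t) * (dot v v - 2 * dot x v + 1).
      by apply: mulr_gt0 => //; lra.
    lra.
  lra.
rewrite leNgt; apply/negP => xv; move: x1; rewrite /unit_sphere /= => x1.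
have vx : 2 * (1 - dot x v) < dot v v - 2 * dot x v + 1 by lra.
have vx0 : 0 < dot v v - 2 * dot x v + 1 by lra.
(* The second root, where the segment meets the sphere again; it is below 1 because [v] lies
   outside. *)
pose q := 2 * (1 - dot x v) / (dot v v - 2 * dot x v + 1).
have q0 : 0 < q by apply: divr_gt0 => //; lra.
have q1 : q < 1 by rewrite ltr_pdivrMr // mul1r.
have qE : q * (dot v v - 2 * dot x v + 1) = 2 * (1 - dot x v).
  by rewrite mulfVK // gt_eqF.
have qqE : q * (q * (dot v v - 2 * dot x v + 1)) = q * (2 * (1 - dot x v)).
  by rewrite qE.
have q01 : 0 <= 1 - q < 1 by apply/andP; split; lra.
have := H _ q01; rewrite !dotL x1 (dotC v x); lra.
Qed.

End VertexVector.

(** * Stereographic projection and vertex balls *)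

Section VertexBall.
Variables (R : realType) (d : nat).
Implicit Types (v x : 'rV[R]_(d + 1)) (p : hatR R d).

Lemma rowP1 x : exists a t, x = row_mx (a : 'rV[R]_d) (const_mx t).
Proof.
exists (lsubmx x), (rsubmx x 0 0); rewrite -[LHS]hsubmxK; congr row_mx.
by apply/matrixP => i j; rewrite !ord1 !mxE.
Qed.

Lemma null_lift_stereo x : unit_sphere x ->
  exists2 k, 0 < k & null_lift (stereo x) = k *: homog x.
Proof.
have [a [t ->]] := rowP1 x; rewrite /unit_sphere /= dot_row_mx1 => aE.
rewrite /stereo row_mxKl row_mxKr mxE /homog -/(lvec a t 1).
have a0 := dot_ge0 a.
case: eqVneq => [t1|t1] /=.
  exists 1 => //; rewrite scale1r t1; congr lvec; apply/esym/eqP.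
  by rewrite -dot_eq0; apply/eqP; move: aE; rewrite t1; lra.
have t1' : 1 - t != 0 by rewrite subr_eq0 eq_sym.
have t0 : 0 < 1 - t.
  by rewrite lt_def t1' /=; nra.
exists (2 / (1 - t)); first exact: divr_gt0.
have aa : dot a a = 1 - t * t by lra.
rewrite lvecZ !dotL aa scalerA; congr lvec.
- by field.
- by field.
Qed.

Lemma stereo_surj p : exists2 x, unit_sphere x & stereo x = p.
Proof.
case: p => [y|].
  have y0 := dot_ge0 y; pose D := dot y y + 1.
  have D0 : dot y y + 1 != 0 by rewrite gt_eqF // ltr_wpDl.
  exists (row_mx ((2 / D) *: y) (const_mx ((D - 2) / D))).
    by rewrite /unit_sphere /= dot_row_mx1 !dotL /D; field.
  have N : 1 - (D - 2) / D = 2 / D by rewrite /D; field.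
  have N0 : 2 / D != 0 by rewrite mulf_neq0 ?invr_eq0 ?pnatr_eq0.
  rewrite /stereo row_mxKl row_mxKr mxE -subr_eq0 -opprB oppr_eq0 N (negPf N0).
  by rewrite scalerA mulVf ?scale1r.
exists (row_mx 0 (const_mx 1)); last by rewrite /stereo row_mxKr mxE eqxx.
by rewrite /unit_sphere /= dot_row_mx1 dot0l mulr1 add0r.
Qed.

(** The lift of [stereo x] is a positive multiple of [homog x], so its product with [nvec v] has the
    sign of [dot x v - 1], which decides visibility. *)
Lemma vertex_ballE v : 1 < dot v v -> vertex_ball v = lball (nvec v).
Proof.
move=> v1; rewrite lball_scale ?invr_gt0 ?sqrtr_gt0 ?subr_gt0 //.
rewrite /vertex_ball visible_capE //; apply/seteqP; split=> [p [x [x1 xv] <-]|p].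
  have [k k0 E] := null_lift_stereo x1.
  by rewrite /lball /= E lorZl lor_homog pmulr_rge0 // subr_ge0.
have [x x1 <-] := stereo_surj p; have [k k0 E] := null_lift_stereo x1.
rewrite /lball /= E lorZl lor_homog pmulr_rge0 // subr_ge0 => xv.
by exists x.
Qed.

End VertexBall.

(** * Combinatorial equivalence *)

Section CombEquiv.
Variables (R : realType) (m m' n : nat).
Variables (V : 'M[R]_(m, n)) (W : 'M[R]_(m', n)).
Variable phi : set 'rV[R]_n -> set 'rV[R]_n.
Hypothesis phi_bij : set_bij (face (hull V)) (face (hull W)) phi.
Hypothesis phi_mono : forall F G, face (hull V) F -> face (hull V) G ->
  (F `<=` G <-> phi F `<=` phi G).

Lemma face_set0 k (U : 'M[R]_(k, n)) : face (hull U) set0.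
Proof.
exists 0, 1; split=> [x _|]; first by rewrite dot0l.
apply/seteqP; split=> // x [_ /= /eqP].
by rewrite dot0l eq_sym oner_eq0.
Qed.

Let phi_face F : face (hull V) F -> face (hull W) (phi F).
Proof. by have [h _ _] := phi_bij; apply: h. Qed.

Let phi_surj G : face (hull W) G -> exists2 F, face (hull V) F & phi F = G.
Proof. by have [_ _ h] := phi_bij; apply: h. Qed.

Lemma comb_equiv_nonempty F : face (hull V) F -> F !=set0 -> phi F !=set0.
Proof.
move=> fF F0; apply/set0P; apply: contraPneq F0 => E.
have H : F `<=` set0 by apply/(phi_mono fF (face_set0 V)); rewrite E.
by move=> [x /H].
Qed.

(** The preimage of [[set u]] is nonempty, so it contains a vertex [v], and the image of [[set v]]
    is a nonempty face inside [[set u]]. *)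
Lemma comb_equiv_vertex_preimage u : vertex (hull W) u ->
  exists2 v, vertex (hull V) v & phi [set v] = [set u].
Proof.
move=> vu; have [F fF E] := phi_surj vu.
have F0 : F !=set0.
  apply/set0P/negP => /eqP F0.
  have [G fG EG] := phi_surj (face_set0 W).
  have : phi F `<=` phi G by apply/(phi_mono fF fG); rewrite F0.
  by rewrite E EG => /(_ u erefl).
have [v vv Fv] := face_has_vertex fF F0; exists v => //.
have sub : phi [set v] `<=` [set u].
  by rewrite -E; apply/(phi_mono vv fF) => x ->.
have [x px] : phi [set v] !=set0 by apply: comb_equiv_nonempty => //; exists v.
apply/seteqP; split=> // y ->.
by rewrite -(sub _ px).
Qed.

Lemma comb_equiv_vertex_image v : vertex (hull V) v ->
  exists2 u, vertex (hull W) u & phi [set v] = [set u].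
Proof.
move=> vv; have p0 : phi [set v] !=set0.
  by apply: comb_equiv_nonempty => //; exists v.
have [u vu pu] := face_has_vertex (phi_face vv) p0; exists u => //.
have [v' vv' E'] := comb_equiv_vertex_preimage vu.
suff -> : v = v' by [].
have : [set v'] `<=` [set v] by apply/(phi_mono vv' vv); rewrite E' => x ->.
by move=> /(_ v' erefl).
Qed.

Lemma comb_equiv_vertex_mem v u F : vertex (hull V) v -> phi [set v] = [set u] ->
  face (hull V) F -> F v <-> phi F u.
Proof.
move=> vv E fF; have := phi_mono vv fF; rewrite E => -[h1 h2]; split=> H.
  by apply: h1 => // x ->.
by apply: h2 => // x ->.
Qed.

End CombEquiv.

(** * Dilations and the face lattice *)

Section Scaling.
Variables (R : realType) (n : nat).
Implicit Types (P F : set 'rV[R]_n) (k : R).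

Definition scaled k P : set 'rV[R]_n := [set k *: x | x in P].

Lemma scaledK k P : k != 0 -> scaled k^-1 (scaled k P) = P.
Proof.
move=> k0; apply/seteqP; split=> [x [_ [y Py <-] <-]|x Px].
  by rewrite scalerA mulVf // scale1r.
by exists (k *: x); [exists x | rewrite scalerA mulVf // scale1r].
Qed.

Lemma scaledS k P F : P `<=` F -> scaled k P `<=` scaled k F.
Proof. by move=> PF x [y /PF Fy <-]; exists y. Qed.

Lemma face_scaled k P F : k != 0 -> face P F -> face (scaled k P) (scaled k F).
Proof.
move=> k0 [a [c [H ->]]]; exists (k^-1 *: a), c.
have E x : dot (k^-1 *: a) (k *: x) = dot a x.
  by rewrite dotZl dotZr mulrA mulVf // mul1r.
split=> [_ [x Px <-]|]; first by rewrite E; apply: H.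
apply/seteqP; split=> [_ [x [Px /= Ex] <-]|_ [[x Px <-]]] /=.
  by rewrite E; split=> //; exists x.
by rewrite E => Ex; exists x.
Qed.

Lemma comb_equiv_scaled k P : k != 0 -> comb_equiv (scaled k P) P.
Proof.
move=> k0; have k0' : k^-1 != 0 by rewrite invr_eq0.
have K A : scaled k (scaled k^-1 A) = A by rewrite -{1}[k]invrK scaledK.
exists (scaled k^-1); split; first split.
- by move=> F fF; rewrite -[P](scaledK P k0); apply: face_scaled.
- by move=> F G _ _ E; rewrite -(K F) E K.
- by move=> F fF; exists (scaled k F); [apply: face_scaled | apply: scaledK].
- move=> F G _ _; split; first exact: scaledS.
  by move=> /(@scaledS k); rewrite !K.
Qed.

Lemma hull_scaled m k (V : 'M[R]_(m, n)) : hull (k *: V) = scaled k (hull V).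
Proof.
apply/seteqP; split=> [x [w [w0 w1 ->]]|_ [_ [w [w0 w1 ->]] <-]].
  by exists (w *m V); [exists w | rewrite scalemxAr].
by exists w; rewrite scalemxAr.
Qed.

End Scaling.

Lemma has_dim1_line (R : realType) n (E : set 'rV[R]_n) x y u :
  has_dim E 1 -> E x -> E y -> x != y -> E u -> exists t, u = x + t *: (y - x).
Proof.
move=> [x0 [B [_ _ _ H]]] Ex Ey xy Eu.
have P w : E w -> exists t, w = x0 + t *: B.
  by move=> /H /sub_rVP [t E']; exists t; rewrite -E' addrC subrK.
have [[a xE] [b yE] [c uE]] := And3 (P x Ex) (P y Ey) (P u Eu).
have ab : b - a != 0.
  by rewrite subr_eq0; apply: contra_neq xy => ba; rewrite xE yE ba.
exists ((c - a) / (b - a)); rewrite uE xE yE.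
by apply/rowP => i; rewrite !mxE; field.
Qed.

(** * The cross polytope *)

Section Cross.
Variables (R : realType) (n : nat).

Definition cross_mx : 'M[R]_(n + n, n) := col_mx 1%:M (- 1%:M).

Definition cvert (b : bool) (i : 'I_n) : 'rV[R]_n := (-1) ^+ (~~ b) *: delta_mx 0 i.

Lemma cross_row k : exists b i, row k cross_mx = cvert b i.
Proof.
rewrite /cross_mx; case: (split_ordP k) => i ->.
  by exists true, i; rewrite rowKu row1 /cvert expr0 scale1r.
by exists false, i; rewrite rowKd linearN /= row1 /cvert expr1 scaleN1r.
Qed.

Lemma cvert_row b i : exists k, row k cross_mx = cvert b i.
Proof.
case: b; [exists (lshift n i) | exists (rshift n i)]; rewrite /cross_mx.
  by rewrite rowKu row1 /cvert expr0 scale1r.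
by rewrite rowKd linearN /= row1 /cvert expr1 scaleN1r.
Qed.

Lemma dot_cvert b c i j :
  dot (cvert b i) (cvert c j) = (-1) ^+ (b (+) c) * (i == j)%:R.
Proof.
rewrite /cvert dotZl dotZr /dot trmx_delta mul_delta_mx_cond mulrA -signr_addb.
have [_|ij] := eqVneq i j; rewrite ?mulr1n ?mulr0n mxE ?eqxx.
  by case: b c => [] [].
by rewrite !mulr0.
Qed.

Lemma cvert_mem b i : cross_polytope R n (cvert b i).
Proof. by have [k <-] := cvert_row b i; apply: hull_row. Qed.

Lemma vertex_cross u : vertex (cross_polytope R n) u -> exists b i, u = cvert b i.
Proof. by move=> /vertex_row [k ->]; apply: cross_row. Qed.

Lemma cross_face_dot a (c : R) : (forall b i, dot a (cvert b i) <= c) ->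
  face (cross_polytope R n) (cross_polytope R n `&` [set x | dot a x = c]).
Proof.
move=> H; exists a, c; split=> // x; apply: hull_le => k.
by have [b [i ->]] := cross_row k.
Qed.

(** The functional [dot (cvert b i)] is 1 at this generator and at most 0 at the others, so no other
    generator can be a vertex of the face it exposes. *)
Lemma cvert_vertex b i : vertex (cross_polytope R n) (cvert b i).
Proof.
have fF : face (cross_polytope R n)
    (cross_polytope R n `&` [set x | dot (cvert b i) x = 1]).
  apply: cross_face_dot => c j; rewrite dot_cvert.
  by case: (_ == _) => /=; case: (b (+) c); rewrite ?expr0 ?expr1; lra.
have [|v vv [_ /= E]] := face_has_vertex fF.
  exists (cvert b i); split=> /=; first exact: cvert_mem.
  by rewrite dot_cvert addbb eqxx mulr1.
suff <- : v = cvert b i by [].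
have [c [j vE]] := vertex_cross vv; move: E; rewrite vE dot_cvert.
have [<-|ij] := eqVneq i j; last by rewrite mulr0 => /eqP; rewrite eq_sym oner_eq0.
by move: b c {vE fF} => [] [] //=; rewrite mulr1 expr1 => ?; exfalso; lra.
Qed.

(** The functional given by [cvert b i + cvert c j] is 1 at these two vertices and at most 0 at all
    others. *)
Lemma cvert_edge b c i j : i != j -> exists F, [/\ face (cross_polytope R n) F,
  F (cvert b i), F (cvert c j)
  & forall e k, F (cvert e k) -> cvert e k = cvert b i \/ cvert e k = cvert c j].
Proof.
move=> ij; exists (cross_polytope R n `&` [set x | dot (cvert b i + cvert c j) x = 1]).
split.
- apply: cross_face_dot => e k; rewrite dotDl !dot_cvert.
  have [ik|ik] := eqVneq i k.
    have -> : (j == k) = false by rewrite -ik eq_sym (negPf ij).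
    by rewrite mulr0 /= mulr1; case: (b (+) e); rewrite ?expr0 ?expr1; lra.
  rewrite mulr0; case: (_ == _); rewrite ?mulr1 ?mulr0 /=;
    by case: (c (+) e); rewrite ?expr0 ?expr1; lra.
- split=> /=; first exact: cvert_mem.
  by rewrite dotDl !dot_cvert addbb eqxx (eq_sym j) (negPf ij) mulr0 mulr1 addr0.
- split=> /=; first exact: cvert_mem.
  by rewrite dotDl !dot_cvert addbb eqxx (negPf ij) mulr0 mulr1 add0r.
- move=> e k [_ /=]; rewrite dotDl !dot_cvert.
  have [ik|ik] := eqVneq i k.
    have -> : (j == k) = false by rewrite -ik eq_sym (negPf ij).
    by move=> H; left; rewrite -ik; move: b e H => [] [] //= H; exfalso;
      move: H; rewrite expr1; lra.
  have [jk|jk] := eqVneq j k.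
    by move=> H; right; rewrite -jk; move: c e H => [] [] //= H; exfalso;
      move: H; rewrite expr1; lra.
  by rewrite !mulr0 addr0 => H; exfalso; lra.
Qed.

End Cross.

(** * From edge-scribed realizations to octahedral systems *)

Section Realization.
Variables (R : realType) (n : nat).

Lemma cvert_inj b c (i j : 'I_n) : cvert R b i = cvert R c j -> i = j /\ b = c.
Proof.
move=> E; have := dot_cvert R b c i j; rewrite -E dot_cvert addbb eqxx mulr1.
have [->|ij] := eqVneq i j; last by rewrite mulr0 expr0 => /eqP; rewrite oner_eq0.
by rewrite mulr1; case: b c {E} => [] [] //=;
  rewrite ?expr0 ?expr1 => ?; exfalso; lra.
Qed.

(** Extracts from the face lattice a labelling of the vertices and, for labels on different axes, a
    face with no further vertices. *)
Lemma cross_realization_vertices m (V : 'M[R]_(m, n)) :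
  comb_equiv (hull V) (cross_polytope R n) ->
  exists v : bool -> 'I_n -> 'rV[R]_n,
  [/\ forall b i, vertex (hull V) (v b i),
      forall u, vertex (hull V) u -> exists b i, u = v b i,
      forall i, v true i != v false i
    & forall b c i j, i != j -> exists F,
      [/\ face (hull V) F, F (v b i), F (v c j), v b i != v c j
        & forall u, vertex (hull V) u -> F u -> u = v b i \/ u = v c j]].
Proof.
move=> [phi [bij mono]].
have pre bi := cid2 (comb_equiv_vertex_preimage bij mono
  (cvert_vertex R bi.1 bi.2)).
pose v b i := sval (pre (b, i)).
have vV b i : vertex (hull V) (v b i) by rewrite /v; case: (pre _).
have vE b i : phi [set v b i] = [set cvert R b i] by rewrite /v; case: (pre _).
have v_inj b c i j : v b i = v c j -> i = j /\ b = c.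
  move=> E; apply: cvert_inj; have := vE b i; rewrite E vE => S.
  by have : [set cvert R c j] (cvert R b i) by rewrite S.
have v_onto u : vertex (hull V) u -> exists b i, u = v b i.
  move=> vu; have [w vw E] := comb_equiv_vertex_image bij mono vu.
  have [b [i wE]] := vertex_cross vw; exists b, i.
  have : [set u] `<=` [set v b i].
    by apply/(mono _ _ vu (vV b i)); rewrite E vE wE.
  by move=> /(_ u erefl).
exists v; split=> // [i|b c i j ij].
  by apply/eqP => /v_inj [].
have [G [fG Gb Gc GH]] := cvert_edge R b c ij.
have [_ _ /(_ G fG) [F fF FG]] := bij.
have mem e k : F (v e k) <-> G (cvert R e k).
  by rewrite -FG; apply: (comb_equiv_vertex_mem mono).
exists F; split=> //; try by apply/mem.
  by apply: contra_neq ij => /v_inj [].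
move=> u /v_onto [e [k ->]] /mem /GH.
by case=> /cvert_inj [-> ->]; [left|right].
Qed.

(** A face whose only vertices are [v] and [w] lies on their line, so it is an edge, with tangency
    point [v + t *: (w - v)]. As both ends are exposed points, [0 <= t <= 1]. *)
Lemma edge_scribed_lor m (V : 'M[R]_(m, n)) F v w :
  edge_scribed (hull V) -> face (hull V) F -> F v -> F w -> v != w ->
  vertex (hull V) v -> vertex (hull V) w ->
  (forall u, vertex (hull V) u -> F u -> u = v \/ u = w) ->
  lor (nvec v) (nvec w) = -1.
Proof.
move=> [_ v1 tang] fF Fv Fw vw vv vw' H.
have line := face_two_vertices fF Fv H.
have /tang [p [Fp pp tp]] : edge (hull V) F.
  split=> //; exists v, (w - v); split=> //.
  - by rewrite /row_free rank_rV subr_eq0 (eq_sym w) vw.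
  - by move=> i; rewrite row_id addrC subrK.
  - by move=> x /line [t ->]; rewrite addrC addKr scalemx_sub.
have [t pE] := line p Fp.
have FV x : F x -> hull V x by case: fF => a [c [_ ->]] [].
(* The functional exposing [x] is strictly smaller at [y], so for negative [s] it would exceed its
   maximum. *)
have ends x y s : vertex (hull V) x -> hull V y -> x != y ->
    hull V (x + s *: (y - x)) -> 0 <= s.
  move=> [a [c [Ha E]]] Hy xy Hs.
  have [Hx /= ax] : (hull V `&` [set z | dot a z = c]) x by rewrite -E.
  have ay : dot a y < c.
    rewrite lt_def Ha // andbT; apply: contra_neq xy => ay.
    by have : [set x] y by rewrite E.
  by have := Ha _ Hs; rewrite !dotL ax gerDl nmulr_lle0 ?subr_lt0.
have t0 : 0 <= t by apply: (ends v w) => //; rewrite -?pE; apply: FV.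
have t1 : 0 <= 1 - t.
  apply: (ends w v) => //; rewrite 1?eq_sym //; first exact: FV.
  rewrite (_ : _ + _ = p); first exact: FV.
  by rewrite pE; apply/rowP => i; rewrite !mxE; ring.
by apply: (lor_nvec_tangent _ _ _ pE pp); rewrite ?v1 ?tp // t0 -subr_ge0.
Qed.

Lemma edge_scribed_octahedral m (V : 'M[R]_(m, n)) :
  edge_scribed (hull V) -> comb_equiv (hull V) (cross_polytope R n) ->
  exists v : bool -> 'I_n -> 'rV[R]_n,
  [/\ forall b i, vertex (hull V) (v b i),
      forall u, vertex (hull V) u -> exists b i, u = v b i
    & octahedral (fun b i => nvec (v b i))].
Proof.
move=> es /cross_realization_vertices [v [vV onto vD vE]].
have [_ v1 _] := es; have {}v1 b i := v1 _ (vV b i).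
exists v; split=> //; split=> [b i|b c i j ij|b i|i].
- exact: lor_nvec_nvec.
- have [F [fF Fv Fw vw FH]] := vE b c i j ij.
  exact: (edge_scribed_lor es fF).
- exact: timepart_nvec_gt0.
- by apply: contra_neq (vD i) => /nvec_inj; apply.
Qed.

End Realization.

(** * An edge-scribed cross polytope *)

Section Scribable.
Variables (R : realType) (n : nat).
Hypothesis n_gt1 : (1 < n)%N.

Let i0 : 'I_n := Ordinal (ltnW n_gt1).

Lemma cross_scaled_polytope (k : R) : k != 0 ->
  polytope n (scaled k (cross_polytope R n)).
Proof.
move=> k0; split.
  by exists (n + n)%N, (k *: cross_mx R n); rewrite hull_scaled.
exists 0, (k%:M); split.
- exists 0; last by rewrite scaler0.
  have := hull_convex (cvert_mem R true i0) (cvert_mem R false i0).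
  move=> /(_ 2^-1) H.
  rewrite (_ : 0 = cvert R true i0 + 2^-1 *: (cvert R false i0 - cvert R true i0)).
    by apply: H; apply/andP; split; lra.
  by apply/rowP => i; rewrite !mxE /=; field.
- by rewrite row_free_unit unitmxE det_scalar unitfE expf_neq0.
- move=> i; rewrite add0r; exists (cvert R true i); first exact: cvert_mem.
  by rewrite /cvert expr0 scale1r -scalemx1 linearZ /= row1.
- move=> x _; rewrite submx_full // row_full_unit unitmxE det_scalar.
  by rewrite unitfE expf_neq0.
Qed.

(** Vertices [k *: cvert] on different axes have a midpoint of squared norm [k ^+ 2 / 2], whence the
    factor; the edge touches the sphere there. The work lies in showing that every edge contains two
    such vertices. *)
Lemma scaled_cross_edge_scribed :
  edge_scribed (scaled (Num.sqrt 2) (cross_polytope R n)).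
Proof.
set k := Num.sqrt 2; have k2 : k * k = 2 by rewrite -expr2 sqr_sqrtr.
have k0 : k != 0 by rewrite gt_eqF // sqrtr_gt0.
pose V := k *: cross_mx R n.
have VE : scaled k (cross_polytope R n) = hull V by rewrite hull_scaled.
have rowE l : exists b i, row l V = k *: cvert R b i.
  by have [b [i E]] := cross_row R l; exists b, i; rewrite /V linearZ /= E.
have Erow b i : exists l, row l V = k *: cvert R b i.
  by have [l E] := cvert_row R b i; exists l; rewrite /V linearZ /= E.
have dk b c (i j : 'I_n) : dot (k *: cvert R b i) (k *: cvert R c j) =
    2 * ((-1) ^+ (b (+) c) * (i == j)%:R).
  by rewrite dotZl dotZr mulrA k2 dot_cvert.
split; first exact: cross_scaled_polytope.
  rewrite VE => v /vertex_row [l ->]; have [b [i ->]] := rowE l.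
  by rewrite dk addbb eqxx mulr1 mulr1; lra.
rewrite VE => E [fE dE].
have [x0 [B [Ex0 freeB ExB _]]] := dE.
have xB : x0 + B != x0.
  apply: contraTneq freeB => /eqP; rewrite -subr_eq0 addrC addKr => /eqP ->.
  by rewrite /row_free mxrank0.
have [l1 El1] := face_row fE Ex0.
(* If all generators on [E] coincided, [E] would be a point, against dimension 1. *)
have [l2 El2 l12] : exists2 l, E (row l V) & row l1 V != row l V.
  apply: contrapT => N; have all_eq u : vertex (hull V) u -> E u ->
      u = row l1 V \/ u = row l1 V.
    move=> /vertex_row [l ->] Eu; left; apply/eqP; apply: contrapT => /negP D.
    by apply: N; exists l => //; rewrite eq_sym.
  have const x : E x -> x = row l1 V.
    move=> /(face_two_vertices fE El1 all_eq) [t ->].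
    by rewrite subrr scaler0 addr0.
  case/negP: xB; apply/eqP; rewrite (const _ Ex0).
  by have := ExB 0; rewrite row_id (const _ Ex0) => /const.
have [b [i r1E]] := rowE l1; have [c [j r2E]] := rowE l2.
rewrite r1E in El1 l12; rewrite r2E in El2 l12.
have [a [e [Ha EE]]] := fE.
have line := has_dim1_line dE El1 El2 l12.
have aE x : E x -> dot a x = e by rewrite EE => -[].
(* On opposite vertices [a] takes opposite values, so [e = 0]. Then [a] vanishes on any other axis,
   and [E] contains a vertex off the line. *)
have ij : i != j.
  apply/negP => /eqP ij; subst j.
  have cE : k *: cvert R c i = - (k *: cvert R b i).
    have cb : c = ~~ b.
      by move: l12; case: b c {r1E r2E El1 El2 line} => [] []; rewrite ?eqxx.
    by rewrite cb -scalerN; congr (_ *: _); rewrite /cvert -scaleNr -signrN.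
  have e0 : e = 0.
    have := aE _ El2; rewrite cE dotNr (aE _ El1) => ?; lra.
  have /card_gt0P [i' i'i] : (0 < #|predC1 i|)%N.
    by rewrite cardC1 card_ord -ltnS prednK // ltnW.
  rewrite inE in i'i.
  have Ei' : E (k *: cvert R true i').
    have hV b' : hull V (k *: cvert R b' i').
      by have [l <-] := Erow b' i'; apply: hull_row.
    rewrite EE; split=> //=; have := Ha _ (hV true); have := Ha _ (hV false).
    by rewrite e0 /cvert expr0 expr1 scale1r scaleN1r scalerN dotNr; lra.
  have [t tE] := line _ Ei'.
  have := dk true true i' i'.
  rewrite {2}tE cE dotDr (dotZr t) dotDr !dotNr !dk (negPf i'i) eqxx !mulr0.
  rewrite addbb expr0 !mulr1 oppr0 addr0 mulr0 addr0 => /eqP.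
  by rewrite eq_sym pnatr_eq0.
pose p := k *: cvert R b i + 2^-1 *: (k *: cvert R c j - k *: cvert R b i).
have dij : dot (k *: cvert R b i) (k *: cvert R c j) = 0.
  by rewrite dk (negPf ij) !mulr0.
have dii b' (i' : 'I_n) : dot (k *: cvert R b' i') (k *: cvert R b' i') = 2.
  by rewrite dk addbb eqxx !mulr1.
have hV x : E x -> hull V x by rewrite EE => -[].
exists p; split.
- rewrite EE; split=> /=.
    by apply: hull_convex; [exact: hV | exact: hV | apply/andP; split; lra].
  by rewrite /p !(dotDr a, dotNr a, dotZr _ a) -!dotZr !aE //; field.
- move: (dii b i) (dii c j) dij.
  rewrite /unit_sphere /= /p; move: (k *: _) (k *: _) => v u uu vv uv.
  by rewrite !dotL (dotC v u) uu vv uv; field.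
- move=> x /line [t ->]; move: (dii b i) (dii c j) dij.
  rewrite /p; move: (k *: _) (k *: _) => v u uu vv uv.
  by rewrite !dotL (dotC v u) uu vv uv; field.
Qed.

Lemma cross_polytope_edge_scribable : edge_scribable (cross_polytope R n).
Proof.
split.
  have := cross_scaled_polytope (oner_neq0 R).
  rewrite (_ : scaled 1 _ = cross_polytope R n) //.
  by apply/seteqP; split=> [_ [x Cx <-]|x Cx];
    [rewrite scale1r | exists x; rewrite ?scale1r].
exists (scaled (Num.sqrt 2) (cross_polytope R n)); split.
  exact: scaled_cross_edge_scribed.
by apply: comb_equiv_scaled; rewrite gt_eqF // sqrtr_gt0.
Qed.

End Scribable.

Theorem theorem2 (R : realType) (d : nat) (hd : (2 <= d)%N) :
  moebius_unique (cross_polytope R (d + 1)).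
Proof.
split; first by apply: cross_polytope_edge_scribable; rewrite addn1 ltnS ltnW.
move=> P1 P2 [es1 ce1] [es2 ce2].
have [[[m1 [V1 E1]] _] s1 _] := es1; have [[[m2 [V2 E2]] _] s2 _] := es2.
rewrite {}E1 {}E2 in es1 ce1 s1 es2 ce2 s2 *.
have [v [vV vO oX]] := edge_scribed_octahedral es1 ce1.
have [w [wV wO oY]] := edge_scribed_octahedral es2 ce2.
have [f mf fE] := octahedral_transport hd oX oY.
exists f; split=> //.
(* Balls with equal labels correspond, and the labels exhaust the vertices of both polytopes. *)
have fb b i : f @` vertex_ball (v b i) = vertex_ball (w b i).
  by rewrite !vertex_ballE ?fE //; [apply: s2 | apply: s1].
apply/seteqP; split=> [_ [_ [u vu <-] <-]|_ [u wu <-]].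
  have [b [i ->]] := vO _ vu; rewrite fb.
  by exists (w b i).
have [b [i ->]] := wO _ wu; rewrite -fb.
by exists (vertex_ball (v b i)) => //; exists (v b i).
Qed.
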